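(* Let $a\in\mathbb C$ and $j\in\mathbb Z$. The graded subspaces of $\mathcal{SD}^{\sigma_{++,a}}$ of degrees $j$ and $j-\frac12$ are $$\mathcal{SD}^{\sigma_{++,a}}_j=\{\partial_\theta\theta\, t^jf(D)-\theta\partial_\theta\, t^jf(-D-j+a)\mid f\in\mathbb C[w]\},$$ $$\mathcal{SD}^{\sigma_{++,a}}_{j-1/2}=\{\theta\, t^{j-1}f(D+(j-a-1)/2)+\partial_\theta\, t^jg(D+(j-a)/2)\mid f\in\mathbb C^{(1)}[w],\ g\in\mathbb C^{(0)}[w]\}.$$
   Context: $\mathcal{SD}$ is the Lie superalgebra (supercommutator bracket) of the associative superalgebra over $\mathbb C$ generated by even $t^{\pm1}$, $D=t\frac{d}{dt}$ and odd $\theta,\partial_\theta$, with $f(D)t=tf(D+1)$, $\theta^2=\partial_\theta^2=0$, $\theta\partial_\theta+\partial_\theta\theta=1$, $\theta,\partial_\theta$ commuting with $t,D$. It has basis $t^kD^l$ ($k\in\mathbb Z,l\ge0$) times $\theta\partial_\theta,\partial_\theta\theta,\theta,\partial_\theta$. It is $\frac12\mathbb Z$-graded (principal gradation) by $wt(t)=1$, $wt(D)=0$, $wt(\theta)=\frac12$, $wt(\partial_\theta)=-\frac12$. The anti-involution $\sigma_{++,a}$ is the $\mathbb C$-linear map with $\sigma(XY)=(-1)^{|X||Y|}\sigma(Y)\sigma(X)$ determined by $t\mapsto t$, $D\mapsto-D+a$, $\theta\mapsto\theta$, $\partial_\theta\mapsto-\partial_\theta$. For an anti-involution $\sigma$ put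 $\mathcal{SD}^\sigma=\{e\in\mathcal{SD}\mid\sigma(e)=-e\}$, graded by the principal gradation. $\mathbb C^{(0)}[w]$ (resp. $\mathbb C^{(1)}[w]$) is the space of even (resp. odd) polynomials in $w$. *)

(* Defs.v *)
From HB Require Import structures.
From mathcomp Require Import all_boot all_order all_algebra.
From mathcomp Require Import finmap classical_sets.
From mathcomp.multinomials Require Import monalg.

Set Implicit Arguments.
Unset Strict Implicit.
Unset Printing Implicit Defensive.

Import Order.TTheory GRing.Theory Num.Theory.
Local Open Scope ring_scope.
Local Open Scope classical_set_scope.

Section LinearCombinations.
Variables (F : fieldType) (V : lmodType F) (I : eqType) (b : I -> V).

Definition span_of (P : pred I) : set V :=
  [set x | exists r : seq (F * I),
     all (fun ci => P ci.2) r /\ x = \sum_(ci <- r) ci.1 *: b ci.2].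

Definition is_basis : Prop :=
  span_of predT = setT /\
  forall (s : seq I) (c : I -> F),
    uniq s -> \sum_(i <- s) c i *: b i = 0 -> {in s, forall i, c i = 0}.

End LinearCombinations.

(* The four products theta dtheta, dtheta theta, theta, dtheta. *)
Variant odd_word := ThetaDtheta | DthetaTheta | Theta | Dtheta.

Definition odd_word_code (e : odd_word) : nat :=
  match e with ThetaDtheta => 0 | DthetaTheta => 1 | Theta => 2 | Dtheta => 3 end.
Definition odd_word_decode (n : nat) : odd_word :=
  match n with 0 => ThetaDtheta | 1 => DthetaTheta | 2 => Theta | _ => Dtheta end.
Lemma odd_word_codeK : cancel odd_word_code odd_word_decode.
Proof. by case. Qed.
HB.instance Definition _ := Equality.copy odd_word (can_type odd_word_codeK).

(* [(k, l, e)] stands for the monomial t^k D^l e. *)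
Definition monom_index : Type := (int * nat * odd_word)%type.
HB.instance Definition _ := Equality.on monom_index.

Definition parity (i : monom_index) : bool :=
  match i.2 with ThetaDtheta | DthetaTheta => false | Theta | Dtheta => true end.

Definition weight (i : monom_index) : rat :=
  i.1.1%:~R + match i.2 with
              | ThetaDtheta | DthetaTheta => 0
              | Theta => 2^-1
              | Dtheta => - 2^-1
              end.

Section Monomials.
Variables (A : nzRingType) (t tinv D theta dtheta : A).

(* Integer powers of t, without requiring a [unitRingType] structure on A. *)
Definition laurent_power (k : int) : A :=
  match k with Posz n => t ^+ n | Negz n => tinv ^+ n.+1 end.

Definition monom (i : monom_index) : A :=
  laurent_power i.1.1 * D ^+ i.1.2 *
  match i.2 with
  | ThetaDtheta => theta * dtheta
  | DthetaTheta => dtheta * theta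
  | Theta => theta
  | Dtheta => dtheta
  end.

End Monomials.

(* The presentation of SD together with its monomial basis; this pins the    *)
(* algebra with its generators down up to a unique isomorphism.              *)
(* [horner_alg x f] is f(x) for x in an algebra.                             *)
Record superdiff_algebra (F : fieldType) := SuperdiffAlgebra {
  SD :> algType F;
  SD_t : SD;
  SD_tinv : SD;
  SD_D : SD;
  SD_theta : SD;
  SD_dtheta : SD;
  SD_mul_t_tinv : SD_t * SD_tinv = 1;
  SD_mul_tinv_t : SD_tinv * SD_t = 1;
  SD_mul_D_t : forall f : {poly F},
    horner_alg SD_D f * SD_t = SD_t * horner_alg (SD_D + 1) f;
  SD_theta_sq : SD_theta ^+ 2 = 0;
  SD_dtheta_sq : SD_dtheta ^+ 2 = 0;
  SD_clifford : SD_theta * SD_dtheta + SD_dtheta * SD_theta = 1;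
  SD_theta_t : SD_theta * SD_t = SD_t * SD_theta;
  SD_theta_D : SD_theta * SD_D = SD_D * SD_theta;
  SD_dtheta_t : SD_dtheta * SD_t = SD_t * SD_dtheta;
  SD_dtheta_D : SD_dtheta * SD_D = SD_D * SD_dtheta;
  SD_basis : is_basis (monom SD_t SD_tinv SD_D SD_theta SD_dtheta)
}.

Arguments SD_t {F} s.
Arguments SD_tinv {F} s.
Arguments SD_D {F} s.
Arguments SD_theta {F} s.
Arguments SD_dtheta {F} s.

Section SuperdiffAlgebra.
Variables (F : fieldType) (S : superdiff_algebra F).

Definition SD_monom : monom_index -> S :=
  monom (SD_t S) (SD_tinv S) (SD_D S) (SD_theta S) (SD_dtheta S).

Definition SD_tpow : int -> S := laurent_power (SD_t S) (SD_tinv S).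

Definition SD_parity (p : bool) : set S :=
  span_of SD_monom (fun i => parity i == p).

Definition SD_degree (d : rat) : set S :=
  span_of SD_monom (fun i => weight i == d).

Definition super_antimultiplicative (sigma : S -> S) : Prop :=
  forall (p q : bool) (X Y : S), SD_parity p X -> SD_parity q Y ->
    sigma (X * Y) = (-1) ^+ (p && q) * (sigma Y * sigma X).

(* The fixed space, in degree d, of minus sigma. *)
Definition SD_sigma (sigma : S -> S) (d : rat) : set S :=
  SD_degree d `&` [set X | sigma X = - X].

Definition is_sigma_pp (a : F) (sigma : {linear S -> S}) : Prop :=
  super_antimultiplicative sigma /\
  [/\ sigma (SD_t S) = SD_t S,
      sigma (SD_D S) = - SD_D S + a%:A,
      sigma (SD_theta S) = SD_theta S &
      sigma (SD_dtheta S) = - SD_dtheta S].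

End SuperdiffAlgebra.

Definition even_polys (F : fieldType) : set {poly F} :=
  [set f | f \Po (- 'X) = f].
Definition odd_polys (F : fieldType) : set {poly F} :=
  [set f | f \Po (- 'X) = - f].

(* The hypotheses are satisfiable: a concrete algebra with all the fields of *)
(* [superdiff_algebra], carrying a map sigma as in [is_sigma_pp].            *)
Module SuperdiffModel.

Section Ext.
Variables (G V : zmodType).
Implicit Types (h : int -> {additive G -> V}) (g : {malg G[int]}).

Definition ext h g : V := (\sum_(k <- msupp g) h k g@_k)%R.

Lemma extEw h g (d : {fset int}) : (msupp g `<=` d)%fset ->
  ext h g = \sum_(k <- d) h k g@_k.
Proof.
move=> le; rewrite /ext (big_fset_incl _ le) // => k _ /mcoeff_outdom ->.
by rewrite raddf0.
Qed.

Lemma ext_additive h : additive (ext h).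
Proof.
move=> g1 g2.
rewrite (@extEw _ (g1 - g2) (msupp g1 `|` msupp g2)%fset) ?msuppB_le //.
rewrite (@extEw _ g1 (msupp g1 `|` msupp g2)%fset) ?fsubsetUl //.
rewrite (@extEw _ g2 (msupp g1 `|` msupp g2)%fset) ?fsubsetUr //.
by rewrite -sumrB; apply: eq_bigr => k _; rewrite mcoeffB raddfB.
Qed.

HB.instance Definition _ h := GRing.isZmodMorphism.Build _ _ (ext h) (ext_additive h).

Lemma extU h k M : ext h << M *g k >> = h k M.
Proof.
by rewrite (extEw _ (@msuppU_le _ _ k M)) big_seq_fset1 mcoeffUU.
Qed.

Lemma eq_additive (f1 f2 : {additive {malg G[int]} -> V}) :
  (forall k M, f1 << M *g k >> = f2 << M *g k >>) -> f1 =1 f2.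
Proof.
by move=> e g; rewrite (monalgE g) !raddf_sum; apply: eq_bigr => k _.
Qed.
End Ext.

(* SD as skew Laurent polynomials sum_k t^k M_k, finitely supported, with M_k a    *)
(* 2x2 matrix over F[D] and M(D) t^l = t^l M(D + l); theta and dtheta are the *)
(* two off-diagonal matrix units.                                            *)
Section Model.
Variable F : fieldType.
Local Notation B := ('M[{poly F}]_2).

Definition shift (l : int) (M : B) : B :=
  map_mx (fun p => p \Po ('X + (l%:~R)%:P)) M.

Lemma shift_multiplicative l : (shift l 1 = 1) * {morph shift l : x y / x * y}.
Proof.
split; first exact: (map_mx1 (comp_poly ('X + (l%:~R)%:P)) 2).
by move=> x y; exact: (map_mxM (comp_poly ('X + (l%:~R)%:P)) x y).
Qed.

Lemma shift_additive l : additive (shift l).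
Proof. by move=> x y; apply/matrixP=> i j; rewrite !mxE raddfB. Qed.
HB.instance Definition _ l := GRing.isZmodMorphism.Build _ _ (shift l) (shift_additive l).
HB.instance Definition _ l := GRing.isMonoidMorphism.Build _ _ (shift l) (shift_multiplicative l).

Lemma shiftD l m M : shift m (shift l M) = shift (l + m) M.
Proof.
apply/matrixP=> i j; rewrite !mxE -comp_polyA; congr (_ \Po _).
by rewrite comp_polyD comp_polyX comp_polyC rmorphD polyCD -addrA [X in 'X + X]addrC.
Qed.

Lemma shift0 M : shift 0 M = M.
Proof. by apply/matrixP=> i j; rewrite !mxE addr0 comp_polyXr. Qed.

Lemma shift_scalar l c : shift l c%:P%:M = c%:P%:M.
Proof. by rewrite /shift (map_scalar_mx (comp_poly _)) /= comp_polyC. Qed.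

Definition sd : Type := {malg B[int]}.
HB.instance Definition _ := GRing.Zmodule.on sd.
Definition U (k : int) (M : B) : sd := mkmalgU k M.
Lemma U_add k : additive (U k). Proof. exact: raddfB. Qed.
HB.instance Definition _ k := GRing.isZmodMorphism.Build _ _ (U k) (U_add k).

Definition mul_aux k M l N := U (k + l) (shift l M * N).
Lemma mul_aux_add k M l : additive (mul_aux k M l).
Proof. by move=> x y; rewrite /mul_aux mulrBr raddfB. Qed.
HB.instance Definition _ k M l := GRing.isZmodMorphism.Build _ _ (mul_aux k M l) (mul_aux_add k M l).

Definition mul_left (g2 : sd) k M : sd := ext (mul_aux k M) g2.
Lemma mul_left_add g2 k : additive (mul_left g2 k).
Proof.
move=> x y; rewrite /mul_left /ext -sumrB; apply: eq_bigr => l _ /=.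
by rewrite /mul_aux raddfB mulrBl raddfB.
Qed.
HB.instance Definition _ g2 k := GRing.isZmodMorphism.Build _ _ (mul_left g2 k) (mul_left_add g2 k).

Definition mul (g1 g2 : sd) : sd := ext (mul_left g2) g1.

Lemma mulU k M l N : mul (U k M) (U l N) = U (k + l) (shift l M * N).
Proof. by rewrite /mul extU /= /mul_left extU. Qed.

Lemma sd_mulDl : left_distributive mul +%R.
Proof. by move=> x y z; rewrite /mul raddfD. Qed.
Lemma sd_mulDr : right_distributive mul +%R.
Proof.
move=> x y z; rewrite /mul /ext -big_split; apply: eq_bigr => k _ /=.
by rewrite /mul_left raddfD.
Qed.

Lemma sd_ind (P : sd -> Prop) : P 0 -> (forall x y, P x -> P y -> P (x + y)) ->
  (forall k M, P (U k M)) -> forall x, P x.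
Proof.
move=> P0 PD PU x; rewrite (monalgE x).
by elim/big_ind: _ => // k _; apply: PU.
Qed.

Lemma sd_mul0l x : mul 0 x = 0. Proof. by rewrite /mul raddf0. Qed.
Lemma sd_mul0r x : mul x 0 = 0.
Proof. by apply: (addrI (mul x 0)); rewrite -sd_mulDr !addr0. Qed.

Lemma sd_mulA : associative mul.
Proof.
move=> x y z; elim/sd_ind: x => [|x x' ix ix'|k M]; first by rewrite !sd_mul0l.
  by rewrite !sd_mulDl ix ix'.
elim/sd_ind: y => [|y y' iy iy'|l N]; first by rewrite sd_mul0r !sd_mul0l sd_mul0r.
  by rewrite !(sd_mulDl, sd_mulDr) iy iy'.
elim/sd_ind: z => [|z z' iz iz'|m P]; first by rewrite !sd_mul0r.
  by rewrite !(sd_mulDl, sd_mulDr) iz iz'.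
by rewrite !mulU rmorphM /= shiftD mulrA addrA.
Qed.
Lemma sd_mul1l : left_id (U 0 1) mul.
Proof.
elim/sd_ind => [|x x' ix ix'|k M]; first by rewrite !sd_mul0r.
  by rewrite !sd_mulDr ix ix'.
by rewrite mulU add0r rmorph1 mul1r.
Qed.
Lemma sd_mul1r : right_id (U 0 1) mul.
Proof.
elim/sd_ind => [|x x' ix ix'|k M]; first by rewrite !sd_mul0l.
  by rewrite !sd_mulDl ix ix'.
by rewrite mulU addr0 shift0 mulr1.
Qed.
Lemma one_neq0 : U 0 1 != 0.
Proof. by rewrite /U monalgU_eq0 oner_neq0. Qed.
HB.instance Definition _ := GRing.Zmodule_isNzRing.Build sd sd_mulA sd_mul1l sd_mul1r sd_mulDl sd_mulDr one_neq0.

Definition scale (c : F) (x : sd) : sd := ((c%:P)%:M : B) *: (x : {malg B[int]}).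
Lemma scaleA a b v : scale a (scale b v) = scale (a * b) v.
Proof. by rewrite /scale scalerA polyCM scalar_mxM. Qed.
Lemma scale1 : left_id 1 scale.
Proof. by move=> v; rewrite /scale polyC1 scale1r. Qed.
Lemma scaleDr : right_distributive scale +%R.
Proof. by move=> c x y; rewrite /scale scalerDr. Qed.
Lemma scaleDl v : {morph scale^~ v : a b / a + b}.
Proof. by move=> x y; rewrite /scale polyCD raddfD scalerDl. Qed.
HB.instance Definition _ := GRing.Zmodule_isLmodule.Build F sd scaleA scale1 scaleDr scaleDl.
Lemma scaleU c k M : c *: U k M = U k (c%:P *: M).
Proof.
apply/malgP=> l; rewrite [LHS]mcoeffZ !mcoeffU.
case: (k == l); last by rewrite !mulr0n mulr0.
by rewrite !mulr1n -mul_scalar_mx.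
Qed.
Lemma mulUE k M l N : U k M * U l N = U (k + l) (shift l M * N).
Proof. exact: mulU. Qed.

Lemma scaleAl (c : F) (u v : sd) : c *: (u * v) = (c *: u) * v.
Proof.
elim/sd_ind: u => [|x x' ix ix'|k M]; first by rewrite !(mul0r, scaler0, mul0r).
  by rewrite !(mulrDl, scalerDr) ix ix'.
elim/sd_ind: v => [|x x' ix ix'|l N]; first by rewrite !(mulr0, scaler0, mulr0).
  by rewrite !(mulrDr, scalerDr) ix ix'.
rewrite !(mulUE, scaleU) -!mul_scalar_mx -!mulmxE !mulmxA; congr (U _ (_ *m _)).
by rewrite mulmxE rmorphM /= shift_scalar.
Qed.
HB.instance Definition _ := GRing.Lmodule_isLalgebra.Build F sd scaleAl.
Lemma scaleAr (c : F) (u v : sd) : c *: (u * v) = u * (c *: v).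
Proof.
elim/sd_ind: u => [|x x' ix ix'|k M]; first by rewrite !(mul0r, scaler0, mul0r).
  by rewrite !(mulrDl, scalerDr) ix ix'.
elim/sd_ind: v => [|x x' ix ix'|l N]; first by rewrite !(mulr0, scaler0, mulr0).
  by rewrite !(mulrDr, scalerDr) ix ix'.
rewrite !(mulUE, scaleU); congr (U _ _).
by rewrite -!mulmxE scalemxAr.
Qed.
HB.instance Definition _ := GRing.Lalgebra_isAlgebra.Build F sd scaleAr.

Definition gt := U 1 1.
Definition gti := U (-1) 1.
Definition gD := U 0 'X%:M.
Definition gth := U 0 (delta_mx 0 1).
Definition gdth := U 0 (delta_mx 1 0).

Lemma U0M M N : U 0 M * U 0 N = U 0 (M * N).
Proof. by rewrite mulUE shift0 addr0. Qed.

Lemma horner_sd q f : horner_alg (U 0 q%:M) f = U 0 (f \Po q)%:M.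
Proof.
elim/poly_ind: f => [|f c ih]; first by rewrite rmorph0 comp_poly0 !raddf0.
rewrite rmorphD rmorphM /= ih horner_algX horner_algC U0M.
rewrite comp_poly_MXaddC !raddfD /= -mulmxE -scalar_mxM; congr (_ + _).
by rewrite scaleU -mul_scalar_mx mulmx1.
Qed.

Lemma gtX n : gt ^+ n = U n 1.
Proof.
elim: n => // n ih; rewrite exprS ih mulUE rmorph1 mulr1.
by congr U; rewrite -intS.
Qed.
Lemma gtiX n : gti ^+ n = U (- n%:Z) 1.
Proof.
elim: n => // n ih; rewrite exprS ih mulUE rmorph1 mulr1.
by congr U; rewrite -opprD -intS.
Qed.
Lemma lp k : laurent_power gt gti k = U k 1.
Proof. by case: k => n; rewrite /= ?gtX // gtiX NegzE. Qed.
Lemma gDX n : gD ^+ n = U 0 ('X^n)%:M.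
Proof.
elim: n => [|n ih]; first by rewrite !expr0.
by rewrite exprS ih U0M exprS -mulmxE -scalar_mxM.
Qed.

Definition E e : B := match e with
  | ThetaDtheta => delta_mx 0 0 | DthetaTheta => delta_mx 1 1
  | Theta => delta_mx 0 1 | Dtheta => delta_mx 1 0 end.

Lemma gthdth : gth * gdth = U 0 (E ThetaDtheta).
Proof. by rewrite U0M -mulmxE mul_delta_mx. Qed.
Lemma gdthth : gdth * gth = U 0 (E DthetaTheta).
Proof. by rewrite U0M -mulmxE mul_delta_mx. Qed.

Lemma monomE i : monom gt gti gD gth gdth i = U i.1.1 ('X^(i.1.2) *: E i.2).
Proof.
case: i => [[k l] e]; rewrite /monom /= lp gDX mulUE addr0 shift0 mul1r.
rewrite -mul_scalar_mx mulmxE.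
by case: e; rewrite /= ?gthdth ?gdthth mulUE addr0 shift0.
Qed.

Definition cf k (p q : 'I_2) (l : nat) (x : sd) : F := (mcoeff k x p q)`_l.
Lemma cf_add k p q l : additive (cf k p q l).
Proof. by move=> x y; rewrite /cf mcoeffB !mxE coefB. Qed.
HB.instance Definition _ k p q l :=
  GRing.isZmodMorphism.Build _ _ (cf k p q l) (cf_add k p q l).
Definition pos e : 'I_2 * 'I_2 := match e with
  | ThetaDtheta => (0,0) | DthetaTheta => (1,1)
  | Theta => (0,1) | Dtheta => (1,0) end.

Lemma cfU k p q l k' M : cf k p q l (U k' M) = if k' == k then (M p q)`_l else 0.
Proof. by rewrite /cf mcoeffU; case: eqP; rewrite ?mulr1n // mulr0n mxE coef0. Qed.

Lemma cf_monom i j c : cf i.1.1 (pos i.2).1 (pos i.2).2 i.1.2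
  (c *: monom gt gti gD gth gdth j) = c *+ (j == i).
Proof.
rewrite monomE scaleU cfU.
have hE : E j.2 (pos i.2).1 (pos i.2).2 = (j.2 == i.2)%:R.
  by case: (i.2); case: (j.2); rewrite mxE.
rewrite !mxE hE coefCM -polyC_natr coefMC coefXn.
case: i j hE => [[k l] e] [[k' l'] e'] _ /=.
rewrite [in RHS](_ : (_ == _) = [&& k' == k, l' == l & e' == e]); last first.
  by rewrite -!pair_eqE /pair_eq /= -pair_eqE /pair_eq /= andbA.
case: (k' == k); rewrite ?mulr0n // [l == _]eq_sym.
case: (l' == l); rewrite ?mul0r ?mulr0 ?mulr0n // mul1r.
by rewrite mulr_natr.
Qed.

Lemma span_add (V : lmodType F) (I : eqType) (b : I -> V) (P : pred I) x y :
  span_of b P x -> span_of b P y -> span_of b P (x + y).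
Proof.
move=> [r [hr ->]] [r' [hr' ->]]; exists (r ++ r').
by rewrite all_cat hr hr' big_cat.
Qed.

Lemma U_span (k : int) (M : B) : span_of (monom gt gti gD gth gdth) predT (U k M).
Proof.
have h0 : span_of (monom gt gti gD gth gdth) predT 0.
  by exists [::]; rewrite big_nil.
have h e : forall f : {poly F}, span_of (monom gt gti gD gth gdth) predT (U k (f *: E e)).
  move=> f; rewrite -[f]coefK poly_def scaler_suml raddf_sum.
  elim/big_ind: _ => //; first exact: span_add.
  move=> i _; exists [:: (f`_i, (k, i : nat, e))]; split => //.
  by rewrite big_seq1 monomE scaleU /= -!mul_polyC scalerA.
rewrite (_ : M = M 0 0 *: E ThetaDtheta + M 1 1 *: E DthetaTheta
               + (M 0 1 *: E Theta + M 1 0 *: E Dtheta)).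
  by rewrite !raddfD; do !apply: span_add; apply: h.
apply/matrixP=> i j; rewrite !mxE.
have h2 (u : 'I_2) : u = 0 \/ u = 1.
  by case: u => [[|[|//]]] ?; [left|right]; apply/val_inj.
by case: (h2 i) (h2 j) => -> [] ->; rewrite /= ?mulr1 ?mulr0 ?addr0 ?add0r.
Qed.

Lemma sd_basis : is_basis (monom gt gti gD gth gdth).
Proof.
split.
  apply/seteqP; split => // x _; elim/sd_ind: x; [|exact: span_add|exact: U_span].
  by exists [::]; rewrite big_nil.
move=> s c us s0 i si.
pose h : {additive sd -> F} := cf i.1.1 (pos i.2).1 (pos i.2).2 i.1.2.
have := congr1 h s0; rewrite (raddf_sum h) (raddf0 h).
rewrite (bigD1_seq i si us) big1; last first.
  move=> j /negbTE ji; rewrite -[LHS]/(cf _ _ _ _ _).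
  by have := cf_monom i j (c j); rewrite ji.
move=> hc; have {hc}: cf i.1.1 (pos i.2).1 (pos i.2).2 i.1.2 (c i *: monom gt gti gD gth gdth i) = 0 by rewrite -[RHS]hc; exact/esym/addr0.
move=> <-.
by have := cf_monom i i (c i); rewrite eqxx.
Qed.

Definition sd_model : superdiff_algebra F.
Proof.
apply: (@SuperdiffAlgebra F sd gt gti gD gth gdth).
- by rewrite mulUE rmorph1 mulr1.
- by rewrite mulUE rmorph1 mulr1.
- move=> f; rewrite horner_sd (_ : gD + 1 = U 0 ('X + 1)%:M); last first.
    by rewrite !raddfD.
  rewrite horner_sd !mulUE addr0 add0r mulr1 shift0 mul1r comp_polyXr; congr U.
  by rewrite /shift (map_scalar_mx (comp_poly _)).
- by rewrite expr2 U0M -mulmxE mul_delta_mx_0 ?raddf0.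
- by rewrite expr2 U0M -mulmxE mul_delta_mx_0 ?raddf0.
- rewrite gthdth gdthth -raddfD -[RHS]/(U 0 1); congr U.
  apply/matrixP=> i j; rewrite !mxE.
  by case: i j => [[|[|//]]] ? [[|[|//]]] ?; rewrite /= ?addr0 ?add0r.
- rewrite !mulUE addr0 add0r mulr1 shift0 mul1r; congr U.
  by rewrite /shift (map_delta_mx (comp_poly _)).
- by rewrite !U0M; congr U; rewrite -mulmxE scalar_mxC.
- rewrite !mulUE addr0 add0r mulr1 shift0 mul1r; congr U.
  by rewrite /shift (map_delta_mx (comp_poly _)).
- by rewrite !U0M; congr U; rewrite -mulmxE scalar_mxC.
- exact: sd_basis.
Defined.

Section Sigma.
Variable a : F.

Definition st (M : B) : B := \matrix_(i, j)
  if i == 0 then (if j == 0 then M 1 1 else M 0 1)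
  else (if j == 0 then - M 1 0 else M 0 0).

Definition qk (k : int) : {poly F} := - 'X + (a - k%:~R)%:P.
Definition sig k M : sd := U k (map_mx (comp_poly (qk k)) (st M)).
Lemma sig_add k : additive (sig k).
Proof.
move=> x y; rewrite /sig -raddfB; congr U; apply/matrixP=> i j; rewrite !mxE.
by do 2 case: ifP => _; rewrite -rmorphB //= opprB opprK addrC.
Qed.
HB.instance Definition _ k := GRing.isZmodMorphism.Build _ _ (sig k) (sig_add k).
Definition sigma (x : sd) : sd := ext sig x.
Lemma sigmaU k M : sigma (U k M) = sig k M. Proof. exact: extU. Qed.
Lemma sigma_addi : additive sigma. Proof. exact: raddfB. Qed.
HB.instance Definition _ := GRing.isZmodMorphism.Build _ _ sigma sigma_addi.

Lemma sigmaD x y : sigma (x + y) = sigma x + sigma y.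
Proof. exact: (raddfD (sigma : {additive sd -> sd})). Qed.

Lemma stZ f M : st (f *: M) = f *: st M.
Proof. by apply/matrixP=> i j; rewrite !mxE; do 2 case: ifP => _; rewrite ?mulrN. Qed.
Lemma mapZ q f (M : B) : map_mx (comp_poly q) (f *: M) = (f \Po q) *: map_mx (comp_poly q) M.
Proof. by apply/matrixP=> i j; rewrite !mxE rmorphM. Qed.

Lemma sigma_scaleD (c : F) (x y : sd) : sigma (c *: x) = c *: sigma x ->
  sigma (c *: y) = c *: sigma y -> sigma (c *: (x + y)) = c *: sigma (x + y).
Proof.
move=> ix iy.
transitivity (sigma (c *: x + c *: y)); first exact: (congr1 sigma (scalerDr c x y)).
transitivity (sigma (c *: x) + sigma (c *: y)); first exact: (sigmaD (c *: x) (c *: y)).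
transitivity (c *: sigma x + c *: sigma y); first exact: (f_equal2 +%R ix iy).
transitivity (c *: (sigma x + sigma y)); first exact: (esym (scalerDr c (sigma x) (sigma y))).
exact: (congr1 (fun z : sd => c *: z) (esym (sigmaD x y))).
Qed.

Lemma sigma_scal : scalable sigma.
Proof.
move=> c; elim/sd_ind => [|x y|k M].
- by rewrite !(scaler0, raddf0).
- exact: sigma_scaleD.
- by rewrite scaleU !sigmaU /sig stZ mapZ comp_polyC scaleU.
Qed.
HB.instance Definition _ := GRing.isScalable.Build F sd sd *:%R sigma sigma_scal.

Definition par e := match e with ThetaDtheta | DthetaTheta => false | Theta | Dtheta => true end.

Lemma st_E q e : map_mx (comp_poly q) (st (E e)) = st (E e).
Proof.
apply/matrixP=> i j; rewrite !mxE.
case: e => /=; do 2 case: ifP => _; rewrite !mxE /=;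
 rewrite ?oppr0 ?comp_poly0 ?rmorphN ?rmorph1 ?rmorph0 //.
Qed.

Lemma shiftE l e : shift l (E e) = E e.
Proof. by case: e; rewrite /shift (map_delta_mx (comp_poly _)). Qed.

Lemma map_st q M : map_mx (comp_poly q) (st M) = st (map_mx (comp_poly q) M).
Proof.
by apply/matrixP=> i j; rewrite !mxE; do 2 case: ifP => _; rewrite ?rmorphN.
Qed.

Lemma map_EE q e e' : map_mx (comp_poly q) (st (E e * E e')) = st (E e * E e').
Proof.
by rewrite map_st; congr st; rewrite (map_mxM (comp_poly q)); case: e e' => [] [];
  rewrite !(map_delta_mx (comp_poly _)).
Qed.

Lemma st_EE e e' : st (E e * E e') = (-1) ^+ (par e && par e') *: (st (E e') * st (E e)).
Proof.
apply/matrixP=> i j; rewrite !mxE !big_ord_recl !big_ord0 !mxE.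
case: i j => [[|[|//]]] ? [[|[|//]]] ?; case: e e' => [] [] /=;
 rewrite ?mxE /= ?(mul0r, mulr0, mulr1, mul1r, addr0, add0r, oppr0, mulrN, mulNr, expr0, expr1, opprK) //.
Qed.

Lemma sigma_EE k l f g e e' :
  sigma (U k (f *: E e) * U l (g *: E e')) =
  (-1) ^+ (par e && par e') * (sigma (U l (g *: E e')) * sigma (U k (f *: E e))).
Proof.
have shZ m h M : shift m (h *: M) = (h \Po ('X + (m%:~R)%:P)) *: shift m M.
  exact: mapZ.
have zz (u v : {poly F}) (M N : B) : (u *: M) * (v *: N) = (u * v) *: (M * N).
  by rewrite -!mulmxE -scalemxAl -scalemxAr scalerA.
have sg m n (M : B) : (-1) ^+ n * U m M = U m ((-1) ^+ n *: M).
  rewrite -signr_odd -[in RHS]signr_odd; case: (odd n); rewrite /= ?expr0 ?expr1.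
    by rewrite mulN1r scaleN1r raddfN.
  by rewrite mul1r scale1r.
have sst m e1 : shift m (st (E e1)) = st (E e1) by exact: st_E.
rewrite mulUE !sigmaU /sig shZ shiftE zz !stZ !mapZ mulUE shZ !st_E sst zz sg addrC.
congr U; rewrite map_EE st_EE !scalerA mulrC; congr (_ *: _); congr (_ * _).
rewrite comp_polyM mulrC -!comp_polyA; congr ((_ \Po _) * (_ \Po _)).
  have -> : qk l \Po ('X + (k%:~R)%:P) = - ('X + (k%:~R)%:P) + (a - l%:~R)%:P.
    by rewrite /qk comp_polyD comp_polyC linearN /= comp_polyX.
  rewrite /qk opprD -addrA -polyCN -polyCD; congr (_ + _%:P).
  by rewrite rmorphD opprD addrA addrC.
rewrite /qk comp_polyD comp_polyX comp_polyC -addrA -polyCD; congr (_ + _%:P).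
by rewrite rmorphD opprD addrA addrAC addrNK.
Qed.

Lemma sigma_pp : is_sigma_pp (S := sd_model) a sigma.
Proof.
split; last split.
- move=> p q X Y [r [hr ->]] [r' [hr' ->]].
  have s0 : sigma 0 = 0 by exact: (raddf0 (sigma : {additive sd -> sd})).
  elim: r hr => [|[c i] r ih] /=.
    by rewrite big_nil mul0r s0 mulr0 mulr0.
  case/andP => /eqP pi hr; rewrite big_cons mulrDl !sigmaD {}ih //=.
  rewrite mulrDr mulrDr; congr (_ + _) => {r hr}.
  elim: r' hr' => [|[c' i'] r' ih] /=.
    by rewrite big_nil mulr0 s0 mul0r mulr0.
  case/andP => /eqP qi hr; rewrite big_cons mulrDr !sigmaD {}ih //=.
  rewrite mulrDl mulrDr; congr (_ + _) => {r' hr}.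
  have -> z j : z *: SD_monom sd_model j = U j.1.1 ((z%:P * 'X^(j.1.2)) *: E j.2).
    by rewrite -[SD_monom _ j]/(monom gt gti gD gth gdth j) monomE [LHS]scaleU scalerA.
  have -> z j : z *: SD_monom sd_model j = U j.1.1 ((z%:P * 'X^(j.1.2)) *: E j.2).
    by rewrite -[SD_monom _ j]/(monom gt gti gD gth gdth j) monomE [LHS]scaleU scalerA.
  by rewrite -pi -qi; exact: sigma_EE.
- rewrite -[LHS]/(sigma (U 1 1)) sigmaU /sig -[RHS]/(U 1 1); congr U.
  apply/matrixP=> i j; rewrite !mxE.
  by case: i j => [[|[|//]]] ? [[|[|//]]] ?; rewrite /= ?comp_polyC ?oppr0 ?raddf0 ?comp_poly0 // ?rmorph1.
- rewrite -[LHS]/(sigma (U 0 'X%:M)) sigmaU /sig.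
  rewrite -[RHS]/(- U 0 'X%:M + a *: U 0 1) scaleU -raddfN -raddfD; congr U.
  apply/matrixP=> i j; rewrite !mxE.
  by case: i j => [[|[|//]]] ? [[|[|//]]] ?;
    rewrite /= ?mulr1n ?mulr0n ?mulr0 ?mulr1 ?oppr0 ?comp_poly0 ?comp_polyX ?addr0 // /qk subr0.
- by rewrite -[LHS]/(sigma (U 0 (E Theta))) sigmaU /sig st_E; congr U;
  apply/matrixP=> i j; rewrite !mxE;
  case: i j => [[|[|//]]] ? [[|[|//]]] ?; rewrite /= ?oppr0.
- rewrite -[LHS]/(sigma (U 0 (E Dtheta))) sigmaU /sig st_E -[RHS]/(- U 0 (E Dtheta)) -raddfN.
  congr U; apply/matrixP=> i j; rewrite !mxE.
  by case: i j => [[|[|//]]] ? [[|[|//]]] ?; rewrite /= ?oppr0.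
Qed.
End Sigma.
End Model.

Lemma exists_sigma_pp (F : fieldType) (a : F) :
  exists (S : superdiff_algebra F) (sigma : {linear S -> S}), is_sigma_pp a sigma.
Proof. by exists (sd_model F), (sigma a); exact: sigma_pp. Qed.

End SuperdiffModel.

(* Main.v *)
Require Import Defs.
From mathcomp Require Import all_boot all_order all_algebra.
From mathcomp Require Import classical_sets reals complex.
From mathcomp Require Import zify ring.
Set Implicit Arguments.
Unset Strict Implicit.
Unset Printing Implicit Defensive.
Import GRing.Theory Num.Theory.
Local Open Scope ring_scope.
Local Open Scope classical_set_scope.

(** Every graded piece of SD is spanned by terms t^k f(D) e, with f a
    polynomial and e one of the four words in theta and dtheta. The degree
    pins down the pair (k, e) up to two choices ([SD_degree_int],
    [SD_degree_half]): degree j only allows t^j with the two even words, and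
    degree j - 1/2 only allows t^(j-1) theta and t^j dtheta. The two
    polynomial coefficients are unique because the monomials form a basis
    ([two_terms_inj]).

    On terms sigma is explicit ([sigma_term]). It reverses products, sends D to
    a - D and fixes t; moving t^k back to the left past f(a - D) shifts D by k,
    so f(D) is replaced by f(a - k - D), a reflection of the polynomial
    variable. On words, sigma exchanges the two idempotents theta dtheta and
    dtheta theta, fixes theta and negates dtheta. Uniqueness of coefficients
    then turns sigma X = - X into equations on polynomials.

    In degree j the reflection, being an involution, determines the
    coefficient of theta dtheta from that of dtheta theta, which is free
    ([SD_sigma_int]). In degree j - 1/2 the two coefficients decouple: the one
    of theta is negated by the reflection and the one of dtheta is invariant
    ([SD_sigma_half]). Centring the variable at the fixed point of the
    reflection, which requires dividing by 2, makes them odd and even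
    polynomials respectively ([reflect_eigen]). *)

(** * Evaluating polynomials in an algebra *)

Section HornerAlg.
Variables (F : fieldType) (A : algType F).

Lemma horner_alg_comp (x : A) (f q : {poly F}) :
  horner_alg (horner_alg x q) f = horner_alg x (f \Po q).
Proof.
elim/poly_ind: f => [|f c ih]; first by rewrite comp_poly0 !rmorph0.
rewrite comp_poly_MXaddC !rmorphD !rmorphM /= ih.
by rewrite horner_algX !horner_algC.
Qed.

Lemma comm_horner_alg (x y : A) (f : {poly F}) :
  GRing.comm x y -> GRing.comm x (horner_alg y f).
Proof.
move=> xy; elim/poly_ind: f => [|f c ih].
  by rewrite rmorph0; exact: commr0.
rewrite rmorphD rmorphM /= horner_algX horner_algC.
apply: commrD; first exact: commrM.
by rewrite /GRing.comm mulr_algl mulr_algr.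
Qed.

End HornerAlg.

(** * Spans of subfamilies *)

Section Spans.
Variables (F : fieldType) (V : lmodType F) (I : eqType) (b : I -> V).

Lemma span_of0 (P : pred I) : span_of b P 0.
Proof. by exists [::]; rewrite big_nil. Qed.

Lemma span_of_scaled_gen (P : pred I) c i : P i -> span_of b P (c *: b i).
Proof. by move=> Pi; exists [:: (c, i)]; rewrite /= Pi big_seq1. Qed.

Lemma span_of_sub (P : pred I) (Q : set V) :
    Q 0 -> (forall x y, Q x -> Q y -> Q (x + y)) ->
    (forall c i, P i -> Q (c *: b i)) ->
  span_of b P `<=` Q.
Proof.
move=> Q0 QD Qb x [r [Pr ->]]; elim: r Pr => [_|[c i] r ih /= /andP[Pi Pr]].
  by rewrite big_nil.
by rewrite big_cons; apply: QD; [exact: Qb|exact: ih].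
Qed.

End Spans.

(** * Terms with polynomial coefficients *)

Section Terms.
Variables (F : fieldType) (S : superdiff_algebra F).
Local Notation t := (SD_t S).
Local Notation tinv := (SD_tinv S).
Local Notation D := (SD_D S).
Local Notation theta := (SD_theta S).
Local Notation dtheta := (SD_dtheta S).
Local Notation tpow := (@SD_tpow F S).

Definition word (e : odd_word) : S :=
  match e with
  | ThetaDtheta => theta * dtheta
  | DthetaTheta => dtheta * theta
  | Theta => theta
  | Dtheta => dtheta
  end.

Definition term (k : int) (f : {poly F}) (e : odd_word) : S :=
  tpow k * horner_alg D f * word e.

Lemma termD k f g e : term k (f + g) e = term k f e + term k g e.
Proof. by rewrite /term rmorphD mulrDr mulrDl. Qed.

Lemma termN k f e : term k (- f) e = - term k f e.
Proof. by rewrite /term rmorphN mulrN mulNr. Qed.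

Lemma term0 k e : term k 0 e = 0.
Proof. by rewrite /term rmorph0 mulr0 mul0r. Qed.

Lemma termZ k c f e : term k (c *: f) e = c *: term k f e.
Proof.
rewrite /term -mul_polyC rmorphM /= horner_algC mulr_algl.
by rewrite -scalerAr -scalerAl.
Qed.

Lemma monom_term i : SD_monom S i = term i.1.1 'X^(i.1.2) i.2.
Proof. by rewrite /term rmorphXn /= horner_algX; case: i => [[k l] []]. Qed.

Lemma term_monoms k f e :
  term k f e = \sum_(l < size f) f`_l *: SD_monom S (k, nat_of_ord l, e).
Proof.
have sum n (c : nat -> F) : term k (\sum_(l < n) c l *: 'X^l) e =
    \sum_(l < n) c l *: SD_monom S (k, nat_of_ord l, e).
  elim: n => [|n ih]; first by rewrite !big_ord0 term0.
  by rewrite !big_ord_recr /= termD ih termZ monom_term.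
by rewrite -sum -poly_def coefK.
Qed.

Lemma span_term (P : pred monom_index) k f e :
  (forall l, P (k, l, e)) -> span_of (@SD_monom F S) P (term k f e).
Proof.
move=> Pke; rewrite term_monoms; elim/big_ind: _ => //.
- exact: span_of0.
- by move=> x y; exact: SuperdiffModel.span_add.
- by move=> l _; exact: span_of_scaled_gen.
Qed.

(** The condition on [P] leaves the power of D free, which is why arbitrary
    polynomial coefficients appear. *)
Lemma span_two_words (P : pred monom_index) k e k' e' :
    (forall i, P i = ((i.1.1 == k) && (i.2 == e)) ||
                     ((i.1.1 == k') && (i.2 == e'))) ->
  span_of (@SD_monom F S) P =
    [set term k f e + term k' g e' | f in setT & g in setT].
Proof.
move=> PE; apply/seteqP; split; last first.
  move=> _ [f _] [g _ <-].
  by apply: SuperdiffModel.span_add; apply: span_term => l;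
    rewrite PE /= !eqxx ?orbT.
apply: span_of_sub.
- by exists 0 => //; exists 0 => //; rewrite !term0 addr0.
- move=> _ _ [f _] [g _ <-] [f' _] [g' _ <-].
  exists (f + f') => //; exists (g + g') => //.
  by rewrite !termD addrACA.
- move=> c [[k0 l] e0]; rewrite PE /= => /orP[] /andP[/eqP-> /eqP->].
    exists (c *: 'X^l) => //; exists 0 => //.
    by rewrite termZ term0 addr0 monom_term.
  exists 0 => //; exists (c *: 'X^l) => //.
  by rewrite termZ term0 add0r monom_term.
Qed.

(** The monomials occurring in the two terms are pairwise distinct since their
    words differ, so the linear independence in [SD_basis] applies to the
    combined relation. *)
Lemma two_terms_eq0 k e k' e' f g : e != e' ->
  term k f e + term k' g e' = 0 -> f = 0 /\ g = 0.
Proof.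
move=> ne; rewrite !term_monoms => sum0.
have [_ indep] := SD_basis S.
pose s1 : seq monom_index := [seq (k, l, e) | l <- index_iota 0 (size f)].
pose s2 : seq monom_index := [seq (k', l, e') | l <- index_iota 0 (size g)].
pose c (i : monom_index) := if i.2 == e then f`_(i.1.2) else g`_(i.1.2).
have us : uniq (s1 ++ s2).
  rewrite cat_uniq !map_inj_uniq ?iota_uniq; try by move=> l l' [].
  rewrite andbT /=; apply/hasPn => _ /mapP[l _ ->]; apply/mapP => -[l' _ [_ _ ee]].
  by rewrite ee eqxx in ne.
have cs0 : \sum_(i <- s1 ++ s2) c i *: SD_monom S i = 0.
  rewrite big_cat !big_map !big_mkord -[RHS]sum0.
  congr (_ + _); apply: eq_bigr => l _; rewrite /c /= ?eqxx //.
  by rewrite eq_sym (negbTE ne).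
have {indep cs0} c0 := indep _ _ us cs0.
split; apply/polyP => l; rewrite coef0.
- have [lf|/leq_sizeP/(_ l (leqnn l))//] := ltnP l (size f).
  have := c0 (k, l, e); rewrite /c /= eqxx; apply.
  by rewrite mem_cat; apply/orP; left; apply/mapP; exists l; rewrite ?mem_index_iota.
- have [lg|/leq_sizeP/(_ l (leqnn l))//] := ltnP l (size g).
  have := c0 (k', l, e'); rewrite /c /= eq_sym (negbTE ne); apply.
  by rewrite mem_cat; apply/orP; right; apply/mapP; exists l; rewrite ?mem_index_iota.
Qed.

Lemma two_terms_inj k e k' e' f g f' g' : e != e' ->
  term k f e + term k' g e' = term k f' e + term k' g' e' -> f = f' /\ g = g'.
Proof.
move=> ne /eqP; rewrite -subr_eq0 opprD addrACA -!termN -!termD => /eqP.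
by case/(two_terms_eq0 ne) => /eqP + /eqP; rewrite !subr_eq0 => /eqP-> /eqP->.
Qed.

(** * Homogeneous components *)

Lemma eq_half_int (m n : int) : (m%:~R / 2 == n%:~R / 2 :> rat) = (m == n).
Proof. by rewrite (inj_eq (mulIf _)) // eqr_int. Qed.

(** Doubling the weights turns the question of which monomials have a given
    degree into linear arithmetic over the integers. *)
Lemma weight_halves k l e : weight (k, l, e) =
  (k * 2 + match e with Theta => 1 | Dtheta => -1 | _ => 0 end)%:~R / 2.
Proof. by case: e; rewrite /weight /= !rmorphD rmorphM /=; field. Qed.

Lemma SD_degree_int (j : int) : @SD_degree F S j%:~R =
  [set term j f DthetaTheta + term j h ThetaDtheta | f in setT & h in setT].
Proof.
have j2 : j%:~R = (j * 2)%:~R / 2 :> rat by rewrite intrM; field.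
apply: span_two_words => -[[k l] e]; rewrite weight_halves j2 eq_half_int /=.
by rewrite -!(can_eq odd_word_codeK); case: e => /=; lia.
Qed.

Lemma SD_degree_half (j : int) : @SD_degree F S (j%:~R - 2^-1) =
  [set term (j - 1) f Theta + term j g Dtheta | f in setT & g in setT].
Proof.
have j2 : j%:~R - 2^-1 = (j * 2 - 1)%:~R / 2 :> rat.
  by rewrite intrB intrM; field.
apply: span_two_words => -[[k l] e]; rewrite weight_halves j2 eq_half_int /=.
by rewrite -!(can_eq odd_word_codeK); case: e => /=; lia.
Qed.

(** * Commutation rules *)

(** Commuting with t entails commuting with its inverse:
    t^-1 x = t^-1 x t t^-1 = x t^-1. *)
Lemma comm_tpow x k : GRing.comm x t -> GRing.comm x (tpow k).
Proof.
move=> xt; case: k => n; rewrite /SD_tpow /laurent_power; apply: commrX => //.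
rewrite /GRing.comm -[LHS]mul1r -(SD_mul_tinv_t S) -mulrA [t * _]mulrA -xt.
by rewrite -!mulrA SD_mul_t_tinv mulr1.
Qed.

Lemma comm_word_tpow e k : GRing.comm (word e) (tpow k).
Proof.
have th := comm_tpow k (SD_theta_t S); have dth := comm_tpow k (SD_dtheta_t S).
by case: e => //; apply: commr_sym; apply: commrM; apply: commr_sym.
Qed.

Lemma comm_word_horner e f : GRing.comm (word e) (horner_alg D f).
Proof.
have th : GRing.comm theta D := SD_theta_D S.
have dth : GRing.comm dtheta D := SD_dtheta_D S.
apply: comm_horner_alg.
by case: e => //; apply: commr_sym; apply: commrM; apply: commr_sym.
Qed.

Lemma word_term k f e : word e * tpow k * horner_alg D f = term k f e.
Proof.
by rewrite /term comm_word_tpow -mulrA comm_word_horner mulrA.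
Qed.

Definition translate (k : int) (f : {poly F}) := f \Po ('X + (k%:~R)%:P).

Lemma horner_mul_t f : horner_alg D f * t = t * horner_alg D (translate 1 f).
Proof.
by rewrite SD_mul_D_t -horner_alg_comp rmorphD /= horner_algX horner_algC scale1r.
Qed.

Lemma translateD k l f : translate k (translate l f) = translate (l + k) f.
Proof.
rewrite /translate -comp_polyA comp_polyD comp_polyX comp_polyC.
by rewrite intrD polyCD -addrA [_%:P + _%:P]addrC.
Qed.

Lemma translate0 f : translate 0 f = f.
Proof. by rewrite /translate addr0 comp_polyXr. Qed.

(** Conjugate the rule for t by t^-1, after writing f as the translate by 1 of
    its translate by -1. *)
Lemma horner_mul_tinv f :
  horner_alg D f * tinv = tinv * horner_alg D (translate (-1) f).
Proof.
rewrite -[LHS]mul1r -(SD_mul_tinv_t S) -mulrA; congr (_ * _).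
rewrite mulrA -{1}[f]translate0 -[0](addNr 1) -translateD -horner_mul_t.
by rewrite -mulrA SD_mul_t_tinv mulr1.
Qed.

Lemma horner_mul_tpow f k :
  horner_alg D f * tpow k = tpow k * horner_alg D (translate k f).
Proof.
rewrite /SD_tpow; case: k => n /=.
  elim: n f => [|n ih] f; first by rewrite mul1r mulr1 translate0.
  by rewrite exprS mulrA horner_mul_t -!mulrA ih translateD -intS.
elim: n f => [|n ih] f; first by rewrite horner_mul_tinv.
rewrite exprS mulrA horner_mul_tinv -!mulrA ih translateD.
by rewrite !NegzE -opprD -intS.
Qed.

(** * Parity *)

Lemma word_sum : word ThetaDtheta + word DthetaTheta = 1.
Proof. exact: SD_clifford. Qed.

(** Words of length zero are absent from the monomial basis; evenness of an
    element without theta and dtheta comes from splitting 1 into the two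
    complementary idempotents. *)
Lemma even_tpow_horner k f : SD_parity false (tpow k * horner_alg D f).
Proof.
rewrite -[_ * _]mulr1 -word_sum mulrDr.
by apply: SuperdiffModel.span_add; exact: span_term.
Qed.

Lemma even_tpow k : SD_parity false (tpow k).
Proof. by have := even_tpow_horner k 1; rewrite rmorph1 mulr1. Qed.

Lemma even_horner f : SD_parity false (horner_alg D f : S).
Proof. by have := even_tpow_horner 0 f; rewrite mul1r. Qed.

Lemma parity_word e : SD_parity (parity (0, 0%N, e)) (word e).
Proof.
have := @span_term (fun i => parity i == parity (0, 0%N, e)) 0 1 e.
rewrite /term rmorph1 mulr1 mul1r; apply=> l.
by rewrite /parity.
Qed.

(** * The anti-involution on terms *)

Variables (a : F) (sigma : {linear S -> S}).
Hypothesis sigma_pp : is_sigma_pp a sigma.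

(** No sign appears as soon as the left factor is even. *)
Lemma sigma_evenM q X Y : SD_parity false X -> SD_parity q Y ->
  sigma (X * Y) = sigma Y * sigma X.
Proof. by case: sigma_pp => sM _ X0 Yq; rewrite (sM _ _ _ _ X0 Yq) mul1r. Qed.

Lemma even1 : SD_parity false (1 : S).
Proof. exact: even_tpow 0. Qed.

(** Apply sigma to t * 1 and cancel the unit t = sigma t. *)
Lemma sigma1 : sigma 1 = 1.
Proof.
case: sigma_pp => _ [st _ _ _].
have := sigma_evenM (even_tpow 1) even1.
rewrite mulr1 /SD_tpow /= expr1 st => /(congr1 (fun x => x * tinv)).
by rewrite -mulrA SD_mul_t_tinv mulr1.
Qed.

Lemma even_t : SD_parity false t.
Proof. exact: even_tpow 1. Qed.

Lemma even_tinv : SD_parity false tinv.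
Proof. exact: even_tpow (-1). Qed.

(** Apply sigma to t t^-1 = 1: the image of t^-1 is a left inverse of t. *)
Lemma sigma_tinv : sigma tinv = tinv.
Proof.
case: sigma_pp => _ [st _ _ _].
have := sigma_evenM even_t even_tinv.
rewrite SD_mul_t_tinv sigma1 st => /(congr1 (fun x => x * tinv)).
by rewrite -mulrA SD_mul_t_tinv mulr1 mul1r.
Qed.

Lemma sigma_tpow k : sigma (tpow k) = tpow k.
Proof.
case: sigma_pp => _ [st _ _ _].
rewrite /SD_tpow; case: k => n /=.
  elim: n => [|n ih]; first by rewrite sigma1.
  by rewrite exprS (sigma_evenM even_t (even_tpow n)) st ih -exprSr exprS.
elim: n => [|n ih]; first by rewrite sigma_tinv.
rewrite exprS (sigma_evenM even_tinv (even_tpow (Negz n))) sigma_tinv.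
by rewrite ih -exprSr exprS.
Qed.

Lemma sigma_horner f :
  sigma (horner_alg D f) = horner_alg D (f \Po (a%:P - 'X)).
Proof.
case: sigma_pp => _ [_ sD _ _].
have {}sD : sigma D = horner_alg D (a%:P - 'X).
  by rewrite sD rmorphB /= horner_algX horner_algC addrC.
have eD : SD_parity false D by have := even_horner 'X; rewrite horner_algX.
elim/poly_ind: f => [|f c ih]; first by rewrite comp_poly0 !rmorph0 raddf0.
rewrite comp_poly_MXaddC !rmorphD /= (rmorphM _ f) /= horner_algX !horner_algC.
rewrite linearD linearZ /= sigma1 (sigma_evenM (even_horner f) eD) ih sD.
by rewrite -rmorphM mulrC.
Qed.

(** The effect of sigma on the polynomial coefficient of t^k. *)
Definition reflect (k : int) (f : {poly F}) := f \Po ((a - k%:~R)%:P - 'X).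

Definition dual_word (e : odd_word) : odd_word :=
  match e with
  | ThetaDtheta => DthetaTheta
  | DthetaTheta => ThetaDtheta
  | _ => e
  end.

Definition sigma_sign (e : odd_word) : F := if e is Dtheta then -1 else 1.

(** The exchange of the two idempotents comes from two signs that cancel: one
    from reversing a product of odd elements, one from dtheta |-> - dtheta. *)
Lemma sigma_word e : sigma (word e) = sigma_sign e *: word (dual_word e).
Proof.
case: sigma_pp => sM [_ _ sth sdth].
have pth := parity_word Theta; have pdth := parity_word Dtheta.
case: e => /=; rewrite ?scale1r ?scaleN1r //.
  by rewrite (sM _ _ _ _ pth pdth) sth sdth expr1 mulN1r mulNr opprK.
by rewrite (sM _ _ _ _ pdth pth) sth sdth expr1 mulN1r mulrN opprK.
Qed.

(** Reversing the product gives sigma(e) f(a - D) t^k, and bringing t^k to the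
    left replaces D by D + k, hence a - D by a - k - D. *)
Lemma sigma_term k f e :
  sigma (term k f e) = sigma_sign e *: term k (reflect k f) (dual_word e).
Proof.
rewrite (sigma_evenM (even_tpow_horner k f) (parity_word e)) sigma_word.
rewrite (sigma_evenM (even_tpow k) (even_horner f)) sigma_tpow sigma_horner.
rewrite horner_mul_tpow -word_term -scalerAl mulrA.
congr (_ *: (_ * horner_alg _ _)).
rewrite /translate /reflect -comp_polyA comp_polyB comp_polyX comp_polyC.
by rewrite opprD addrA polyCB addrAC.
Qed.

Lemma reflectN k f : reflect k (- f) = - reflect k f.
Proof. exact: raddfN. Qed.

Lemma reflectK k f : reflect k (reflect k f) = f.
Proof.
rewrite /reflect -comp_polyA comp_polyB comp_polyX comp_polyC subKr.
by rewrite comp_polyXr.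
Qed.

(** * Components of the sigma-anti-invariant space *)

(** Writing X with coefficients f, h, anti-invariance says that h is minus the
    reflection of f and f minus the reflection of h; since the reflection is an
    involution, the first equation implies the second. *)
Lemma SD_sigma_int j : SD_sigma sigma j%:~R =
  [set term j f DthetaTheta - term j (reflect j f) ThetaDtheta | f in setT].
Proof.
rewrite /SD_sigma SD_degree_int; apply/seteqP; split.
  move=> _ [[f _ [h _ <-]]] /=; rewrite raddfD /= !sigma_term /= !scale1r.
  rewrite addrC opprD -!termN => /two_terms_inj-[]// _ fh.
  by exists f => //; rewrite -termN fh opprK.
move=> _ [f _ <-]; rewrite -termN; split.
  by exists f => //; exists (- reflect j f).
rewrite /= raddfD /= !sigma_term /= !scale1r reflectN reflectK.
by rewrite addrC opprD -!termN opprK.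
Qed.

(** The words theta and dtheta are each preserved by sigma up to sign, so the
    two coefficients satisfy independent eigenvector equations; the extra sign
    of sigma on dtheta makes the second eigenvalue +1 rather than -1. *)
Lemma SD_sigma_half j : SD_sigma sigma (j%:~R - 2^-1) =
  [set term (j - 1) f Theta + term j g Dtheta |
    f in [set f | reflect (j - 1) f = - f] & g in [set g | reflect j g = g]].
Proof.
rewrite /SD_sigma SD_degree_half; apply/seteqP; split.
  move=> _ [[f _ [g _ <-]]] /=; rewrite raddfD /= !sigma_term /=.
  rewrite scale1r scaleN1r opprD -!termN => /two_terms_inj-[]// ff gg.
  by exists f => //; exists g => //; apply: oppr_inj.
move=> _ [f /= ff [g /= gg <-]]; split; first by exists f => //; exists g.
rewrite /= raddfD /= !sigma_term /= scale1r scaleN1r ff gg.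
by rewrite opprD -!termN.
Qed.

(** The reflection D |-> a - k - D fixes - c, so in the centred coordinate
    w = D + c it becomes w |-> - w. *)
Lemma reflect_shift k c f : c + c = k%:~R - a ->
  reflect k (f \Po ('X + c%:P)) = (f \Po - 'X) \Po ('X + c%:P).
Proof.
move=> cc; rewrite /reflect -!comp_polyA; congr (_ \Po _).
rewrite comp_polyD raddfN /= !comp_polyX comp_polyC opprD.
rewrite -[in LHS](opprB _ a) -cc polyCN polyCD.
by ring.
Qed.

(** Taking [e] to be minus the identity or the identity identifies the two
    eigenspaces of the reflection with the odd and the even polynomials in the
    centred variable. *)
Lemma reflect_eigen k c (e : {poly F} -> {poly F}) :
    (forall f p, e (f \Po p) = e f \Po p) -> c + c = k%:~R - a ->
  [set f | reflect k f = e f] =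
    [set f \Po ('X + c%:P) | f in [set f | f \Po - 'X = e f]].
Proof.
move=> eC cc; apply/seteqP; split => [f /= ff|_ [f /= ff <-]]; last first.
  by rewrite /= (reflect_shift _ cc) ff eC.
pose g := f \Po ('X - c%:P); have gK : g \Po ('X + c%:P) = f.
  by have := comp_polyXaddC_K f (- c); rewrite polyCN opprK.
exists g => //=.
apply: (can_inj (g := comp_poly ('X - c%:P)) (f := comp_poly ('X + c%:P))).
  by move=> h; exact: comp_polyXaddC_K.
by rewrite -(reflect_shift _ cc) gK ff -eC gK.
Qed.

End Terms.

(** * The two families of components *)

Theorem proposition4p2 (R : realType) (S : superdiff_algebra R[i])
    (a : R[i]) (sigma : {linear S -> S}) (Hsigma : is_sigma_pp a sigma)
    (j : int) :
  let t := @SD_tpow R[i] S in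
  let D := SD_D S in
  let theta := SD_theta S in
  let dtheta := SD_dtheta S in
  SD_sigma sigma j%:~R =
    [set dtheta * theta * t j * horner_alg D f
         - theta * dtheta * t j * horner_alg (- D - j%:~R + a%:A) f
    | f in [set: {poly R[i]}]]
  /\
  SD_sigma sigma (j%:~R - 2^-1) =
    [set theta * t (j - 1) * horner_alg (D + ((j%:~R - a - 1) / 2)%:A) f
         + dtheta * t j * horner_alg (D + ((j%:~R - a) / 2)%:A) g
    | f in @odd_polys R[i] & g in @even_polys R[i]].
Proof.
have shiftE c (f : {poly R[i]}) : horner_alg (SD_D S + c%:A) f =
    horner_alg (SD_D S) (f \Po ('X + c%:P)).
  by rewrite -horner_alg_comp rmorphD /= horner_algX horner_algC.
have reflectE f : horner_alg (- SD_D S - j%:~R + a%:A) f =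
    horner_alg (SD_D S) (reflect a j f).
  rewrite -horner_alg_comp rmorphB /= horner_algX horner_algC.
  by rewrite scalerBl scaler_int addrC [- _ - _]addrC addrA.
have half (x : R[i]) : x / 2 + x / 2 = x by field.
have cf : (j%:~R - a - 1) / 2 + (j%:~R - a - 1) / 2 = (j - 1)%:~R - a.
  by rewrite half intrB addrAC.
have cg := half (j%:~R - a).
move=> t D theta dtheta; split.
  rewrite (SD_sigma_int Hsigma); apply: eq_imagel => f _.
  by rewrite reflectE -!word_term.
rewrite (SD_sigma_half Hsigma).
rewrite (reflect_eigen (e := -%R) _ cf); last by move=> f p; rewrite raddfN.
rewrite (reflect_eigen (e := id) _ cg) //.
apply/seteqP; split => X.
  move=> [_ [f fodd <-] [_ [g geven <-] <-]].
  by exists f => //; exists g => //; rewrite !shiftE -!word_term.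
move=> [f fodd [g geven <-]].
exists (f \Po ('X + ((j%:~R - a - 1) / 2)%:P)); first by exists f.
exists (g \Po ('X + ((j%:~R - a) / 2)%:P)); first by exists g.
by rewrite !shiftE -!word_term.
Qed.
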